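(* Let $n\geq 3$ be a natural number and $R$ a commutative ring. Let $\sigma\in O_{2n+1}(R)$ and let $i,j,k,l\in\Theta_{hb}$ be such that $i\neq\pm j$ and $k\neq\pm l$. Then (i) $T_{kl}(\sigma_{ij})$ is a product of $8$ elementary orthogonal $\sigma$-conjugates, (ii) $T_{kl}(\sigma_{i,-i})$ is a product of $16$ elementary orthogonal $\sigma$-conjugates, (iii) $T_{kl}(\sigma_{i0})$ is a product of $24$ elementary orthogonal $\sigma$-conjugates, (iv) $T_{kl}(2\sigma_{0j})$ is a product of $24$ elementary orthogonal $\sigma$-conjugates, (v) $T_{kl}(\sigma_{ii}-\sigma_{jj})$ is a product of $24$ elementary orthogonal $\sigma$-conjugates, (vi) $T_{kl}(\sigma_{ii}-\sigma_{-i,-i})$ is a product of $48$ elementary orthogonal $\sigma$-conjugates, (vii) $T_{k}(\sigma_{0j})$ is a product of $64n+148$ elementary orthogonal $\sigma$-conjugates, and (viii) $T_{k}(\sigma_{00}-\sigma_{jj})$ is a product of $192n+564$ elementary orthogonal $\sigma$-conjugates.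
   Context: Rings are associative with $1\neq 0$. For group elements, ${}^{h}g:=hgh^{-1}$. Index set: $\Theta:=\{1,\dots,n,0,-n,\dots,-1\}$ and $\Theta_{hb}:=\Theta\setminus\{0\}$. The rows and columns of $(2n+1)\times(2n+1)$ matrices and the coordinates of column vectors $u\in M:=R^{2n+1}$ are indexed by $\Theta$ in the order $1,\dots,n,0,-n,\dots,-1$; $\sigma_{ij}$ denotes the entry of $\sigma$ at position $(i,j)$. Orthogonal group: let $Q:M\to R$, $Q(u)=u_1u_{-1}+\dots+u_nu_{-n}+u_0^2$. Then $O_{2n+1}(R):=\{\sigma\in GL_{2n+1}(R)\mid Q(\sigma u)=Q(u)\ \forall u\in M\}$. Elementary matrices: let $e$ be the identity matrix and $e^{ij}$ ($i,j\in\Theta$) the matrix with $1$ at position $(i,j)$ and $0$ elsewhere. For $i,j\in\Theta_{hb}$ with $i\neq\pm j$ and $x\in R$ set $T_{ij}(x):=e+xe^{ij}-xe^{-j,-i}$. For $i\in\Theta_{hb}$ and $x\in R$ set $T_i(x):=e+xe^{0,-i}-2xe^{i0}-x^2e^{i,-i}$. These matrices lie in $O_{2n+1}(R)$, and the elementary subgroup $EO_{2n+1}(R)$ is the subgroup of $O_{2n+1}(R)$ generated by all of them. For $\sigma\in O_{2n+1}(R)$, an elementary (orthogonal) $\sigma$-conjugate is a matrix of the form ${}^{\epsilon}\sigma^{\pm1}=\epsilon\sigma^{\pm 1}\epsilon^{-1}$ where $\epsilon\in EO_{2n+1}(R)$. *)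

(* Defs.v *)
From mathcomp Require Import all_boot all_order all_algebra.

Set Implicit Arguments.
Unset Strict Implicit.
Unset Printing Implicit Defensive.

Import GRing.Theory.
Local Open Scope ring_scope.

(* The labels 1, ..., n, 0, -n, ..., -1 are encoded, in this order, by the    *)
(* positions 0, ..., 2n: the label 0 is at position n, and the labels i and   *)
(* -i are at mirror-image positions, so that rev_ord is i |-> -i.             *)
Definition th0 (n : nat) : 'I_n.*2.+1 := inord n.

Definition th_opp (n : nat) (i : 'I_n.*2.+1) : 'I_n.*2.+1 := rev_ord i.

Definition hb (n : nat) : {set 'I_n.*2.+1} := [set~ th0 n].

Section OddOrthogonal.

Variables (n : nat) (R : comNzRingType).

Notation M := 'cV[R]_n.*2.+1.
Notation Mat := 'M[R]_n.*2.+1.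

(* invmx is only available over a comUnitRingType; this relational form needs *)
(* no decision procedure for the units of R.                                  *)
Definition inverse_mx (A B : Mat) : Prop := A * B = 1 /\ B * A = 1.

Definition quadQ (u : M) : R :=
  \sum_(i : 'I_n.*2.+1 | (i < n)%N) u i 0 * u (th_opp i) 0 + u (th0 n) 0 ^+ 2.

Definition in_O (sigma : Mat) : Prop :=
  (exists tau, inverse_mx sigma tau) /\
  forall u : M, quadQ (sigma *m u) = quadQ u.

Definition Tl (i j : 'I_n.*2.+1) (x : R) : Mat :=
  1 + x *: delta_mx i j - x *: delta_mx (th_opp j) (th_opp i).

Definition Ts (i : 'I_n.*2.+1) (x : R) : Mat :=
  1 + x *: delta_mx (th0 n) (th_opp i) - (2%:R * x) *: delta_mx i (th0 n)
    - x ^+ 2 *: delta_mx i (th_opp i).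

Inductive EO : Mat -> Prop :=
| EO_long i j x : i \in hb n -> j \in hb n -> i != j -> i != th_opp j ->
    EO (Tl i j x)
| EO_short i x : i \in hb n -> EO (Ts i x)
| EO_one : EO 1
| EO_mul A B : EO A -> EO B -> EO (A * B)
| EO_inv A B : EO A -> inverse_mx A B -> EO B.

Definition elementary_conjugate (sigma A : Mat) : Prop :=
  exists eps eps' tau : Mat,
    [/\ EO eps, inverse_mx eps eps', tau = sigma \/ inverse_mx sigma tau
      & A = eps * tau * eps'].

Definition product_of_conjugates (sigma : Mat) (N : nat) (A : Mat) : Prop :=
  exists s : N.-tuple Mat,
    (forall B, B \in s -> elementary_conjugate sigma B) /\ A = \prod_(B <- s) B.

End OddOrthogonal.

(* Main.v *)
(* With B the polar form of Q, put for isotropic u and v orthogonal to u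
     E(u, v) w = w + B(v, w) u - B(u, w) v - Q(v) B(u, w) u.
   Then T_kl(x) = E(e_k, x e_-l), T_k(x) = E(e_k, - x e_0), isometries g satisfy
   g E(u, v) g^-1 = E(g u, g v), and v |-> E(e_k, v) is a homomorphism.

   Let f be the i-th row of sigma. In the second exterior power of the span of
   e_i, e_j, e_c, the bivector f_i e_j^e_c + f_j e_c^e_i + f_c e_i^e_j is killed
   by contraction with f. Hence, for the corresponding tau in EO,
   rho = sigma tau sigma^-1 fixes e_-i and normalizes the abelian group of all
   E(e_-i, v); moreover rho tau^-1 is a product of 2 conjugates. Taking
   commutators of rho tau^-1, first with a conjugate of E(e_-i, e_j), then with
   E(e_-i, r e_-j), leaves E(e_-i, r f_j e_c): this is (i), with an extra
   factor r. Applying it to elementary conjugates of sigma gives (ii)-(vi).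

   For (vii), rho is compared with the factor T_{j,-c}(f_i) of tau, the other
   factor being a product of 16 conjugates by (i). This gives E(e_-i, y) with
   y = r f_i (f_i sigma e_j - f_j sigma e_i) up to multiples of e_j and e_c; the
   coordinates of y other than y_0 are removed by (i), (ii) and (v), leaving
   T_{-i}(r f_i^2 sigma_0j) up to cheap terms. With r = sigma_{-i,-i}^2, the
   defect 1 - r f_i^2 is a multiple of 1 - sigma_ii sigma_{-i,-i}, and T_kl of
   such a multiple is a product of only 24 conjugates, whatever n: adding to the
   j-th row a suitable combination of the other rows, by an elementary
   conjugation of sigma, gives the entry sigma_ji + B(t, sigma e_i) - Q(t) sigma_{-j,i}.
   Finally (viii) follows by applying (vii) to T_{-j}(1) sigma T_{-j}(-1). *)

Require Import Defs.
From mathcomp Require Import all_boot all_order all_algebra.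
From mathcomp Require Import zify ring.

Set Implicit Arguments.
Unset Strict Implicit.
Unset Printing Implicit Defensive.

Import GRing.Theory.
Local Open Scope ring_scope.

(** * Calculus of two-sided inverses *)

Lemma inverse_mx_mul n (R : comNzRingType) (A A' B B' : 'M[R]_n.*2.+1) :
  inverse_mx A A' -> inverse_mx B B' -> inverse_mx (A * B) (B' * A').
Proof.
move=> [A1 A2] [B1 B2]; split.
  by rewrite mulrA -(mulrA A) B1 mulr1.
by rewrite mulrA -(mulrA B') A2 mulr1.
Qed.

Lemma inverse_mx_sym n (R : comNzRingType) (A A' : 'M[R]_n.*2.+1) :
  inverse_mx A A' -> inverse_mx A' A.
Proof. by case. Qed.

Lemma inverse_mx_uniq n (R : comNzRingType) (A B C : 'M[R]_n.*2.+1) :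
  inverse_mx A B -> inverse_mx A C -> B = C.
Proof. by move=> [_ BA] [eAC _]; rewrite -[B]mulr1 -eAC mulrA BA mul1r. Qed.

Lemma inverse_mx1 n (R : comNzRingType) : inverse_mx (1 : 'M[R]_n.*2.+1) 1.
Proof. by split; rewrite mulr1. Qed.

Lemma inverse_mx_conj n (R : comNzRingType) (A A' B B' : 'M[R]_n.*2.+1) :
  inverse_mx A A' -> inverse_mx B B' ->
  inverse_mx (B * A * B') (B * A' * B').
Proof.
move=> AA' BB'; rewrite -[B * A' * B']mulrA.
exact: inverse_mx_mul (inverse_mx_mul BB' AA') (inverse_mx_sym BB').
Qed.

(** * Indices *)

Section Index.

Variable n : nat.

Lemma val_th0 : th0 n = n :> nat.
Proof. by rewrite /th0 inordK // -addnn; lia. Qed.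

Lemma th_oppK : involutive (@th_opp n).
Proof. exact: rev_ordK. Qed.

Lemma th_opp0 : th_opp (th0 n) = th0 n.
Proof. by apply/val_inj; rewrite /= subSS val_th0; lia. Qed.

Lemma hbE (i : 'I_n.*2.+1) : (i \in hb n) = (i != th0 n).
Proof. by rewrite !inE. Qed.

Lemma th_opp_eq0 (i : 'I_n.*2.+1) : (th_opp i == th0 n) = (i == th0 n).
Proof. by rewrite -(inj_eq (can_inj th_oppK)) th_oppK th_opp0. Qed.

Lemma hb_opp (i : 'I_n.*2.+1) : (th_opp i \in hb n) = (i \in hb n).
Proof. by rewrite !hbE th_opp_eq0. Qed.

Lemma th_opp_eq (i j : 'I_n.*2.+1) : (th_opp i == j) = (i == th_opp j).
Proof. by rewrite -(inj_eq (can_inj th_oppK)) th_oppK. Qed.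

Lemma th_opp_neq (i : 'I_n.*2.+1) : i \in hb n -> i != th_opp i.
Proof.
rewrite hbE; apply: contraNN => /eqP /(congr1 val) /=; rewrite subSS => E.
by apply/eqP/val_inj; rewrite /= val_th0; lia.
Qed.

(* i <> +-j *)
Definition distinct_pairs (i j : 'I_n.*2.+1) := (i != j) && (i != th_opp j).

Lemma distinct_pairsC i j : distinct_pairs i j = distinct_pairs j i.
Proof. by rewrite /distinct_pairs eq_sym -th_opp_eq [th_opp i == j]eq_sym. Qed.

Lemma distinct_pairs_oppr i j :
  distinct_pairs i (th_opp j) = distinct_pairs i j.
Proof. by rewrite /distinct_pairs th_oppK andbC. Qed.

Lemma distinct_pairs_oppl i j :
  distinct_pairs (th_opp i) j = distinct_pairs i j.
Proof. by rewrite distinct_pairsC distinct_pairs_oppr distinct_pairsC. Qed.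

Lemma exists_third_index (i j : 'I_n.*2.+1) : (3 <= n)%N ->
  exists c, [/\ c \in hb n, distinct_pairs c i & distinct_pairs c j].
Proof.
move=> n3.
(* [mu] agrees exactly on i and -i. As n >= 3, the positions 0, 1, 2 lie in three different classes
   of nonzero labels, of which [i] and [j] exclude at most two. *)
pose mu (i : 'I_n.*2.+1) := minn i (n.*2 - i).
have [c [c3 ci cj]] : exists c : nat, [/\ (c < 3)%N, c <> mu i & c <> mu j].
  rewrite /mu; set p := minn i _; set q := minn j _.
  case: (eqVneq p 0%N) => [p0|p0]; case: (eqVneq q 0%N) => [q0|q0];
  case: (eqVneq p 1%N) => [p1|p1]; case: (eqVneq q 1%N) => [q1|q1];
  first [by exists 0%N; split => //; lia | by exists 1%N; split => //; lia
        | by exists 2%N; split => //; lia].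
have vc : (inord c : 'I_n.*2.+1) = c :> nat by rewrite inordK //; lia.
exists (inord c); split.
- by rewrite hbE -val_eqE /= vc val_th0; lia.
- rewrite /distinct_pairs -!val_eqE /= subSS vc; apply/andP.
  by move: ci (ltn_ord i); rewrite /mu; split; lia.
- rewrite /distinct_pairs -!val_eqE /= subSS vc; apply/andP.
  by move: cj (ltn_ord j); rewrite /mu; split; lia.
Qed.

End Index.

(** * Eichler-Siegel transvections *)

Section Transvections.

Variables (n : nat) (R : comNzRingType).

Local Notation I := 'I_n.*2.+1.
Local Notation V := 'cV[R]_n.*2.+1.
Local Notation Mat := 'M[R]_n.*2.+1.
Local Notation o := (th0 n).
Local Notation Q := (@quadQ n R).

Implicit Types (u v w : V) (i j k l m : I) (A : Mat) (x y r : R).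

(** * The polar form of Q *)

Definition ev i : V := delta_mx i 0.

(** The sum over all labels contains u_0 v_0 only once, while u_0^2 polarizes to 2 u_0 v_0; hence
    the extra term. *)
Definition bil u v : R :=
  \sum_i u i 0 * v (th_opp i) 0 + u o 0 * v o 0.

Lemma bilDl u v w : bil (u + v) w = bil u w + bil v w.
Proof.
rewrite /bil; under eq_bigr do rewrite mxE mulrDl.
by rewrite big_split mxE /=; ring.
Qed.

Lemma bilZl x u v : bil (x *: u) v = x * bil u v.
Proof.
rewrite /bil; under eq_bigr do rewrite mxE -mulrA.
by rewrite -mulr_sumr mxE /=; ring.
Qed.

Lemma bilC u v : bil u v = bil v u.
Proof.
rewrite /bil (reindex_inj (can_inj (@th_oppK n))) /= mulrC; congr (_ + _).
by apply: eq_bigr => i _; rewrite th_oppK mulrC.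
Qed.

Lemma bilDr u v w : bil u (v + w) = bil u v + bil u w.
Proof. by rewrite bilC bilDl !(bilC u). Qed.

Lemma bilZr x u v : bil u (x *: v) = x * bil u v.
Proof. by rewrite bilC bilZl (bilC u). Qed.

Lemma bilNl u v : bil (- u) v = - bil u v.
Proof. by rewrite -scaleN1r bilZl mulN1r. Qed.

Lemma bilNr u v : bil u (- v) = - bil u v.
Proof. by rewrite -scaleN1r bilZr mulN1r. Qed.

Lemma bil0r u : bil u 0 = 0.
Proof. by rewrite -(scale0r u) bilZr mul0r. Qed.

Lemma quadQD u v : Q (u + v) = Q u + Q v + bil u v.
Proof.
(* The labels past 0, reflected by [th_opp], give the first half sum with [u] and [v] exchanged. *)
have E : \sum_i u i 0 * v (th_opp i) 0 =
  \sum_(i : I | (i < n)%N) u i 0 * v (th_opp i) 0 +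
  (\sum_(i : I | (i < n)%N) v i 0 * u (th_opp i) 0 + u o 0 * v o 0).
  rewrite (bigID (fun i : I => (i < n)%N)) /=; congr (_ + _).
  rewrite (bigD1 o) /= ?val_th0 ?ltnn // th_opp0 addrC; congr (_ + _).
  rewrite (reindex_inj (can_inj (@th_oppK n))) /=.
  apply: eq_big => [i|i _]; last by rewrite th_oppK mulrC.
  rewrite th_opp_eq0 -val_eqE /= val_th0 subSS.
  by have := ltn_ord i; lia.
rewrite /bil E /quadQ.
under eq_bigr do rewrite !mxE mulrDl !mulrDr.
rewrite !big_split !mxE /=.
ring.
Qed.

Lemma quadQZ x u : Q (x *: u) = x ^+ 2 * Q u.
Proof.
rewrite /quadQ mulrDr mulr_sumr !mxE exprMn; congr (_ + _).
by apply: eq_bigr => i _; rewrite !mxE; ring.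
Qed.

Lemma quadQN u : Q (- u) = Q u.
Proof. by rewrite -scaleN1r quadQZ; ring. Qed.

Lemma quadQ_ev i : Q (ev i) = (i == o)%:R.
Proof.
rewrite /quadQ big1 ?add0r => [|k kn].
  by rewrite mxE eqxx andbT eq_sym; case: eqP => _; rewrite ?expr1n ?expr0n.
rewrite !mxE !eqxx !andbT.
case: eqP => [<-|]; last by rewrite mul0r.
rewrite [_ == k]eq_sym; case: eqP => [E|]; last by rewrite mulr0.
have := @th_opp_neq n k; rewrite -E eqxx hbE -val_eqE /= val_th0.
by rewrite neq_ltn kn => /(_ isT).
Qed.

Lemma quadQ_ev0 : Q (ev o) = 1.
Proof. by rewrite quadQ_ev eqxx. Qed.

Lemma bil_evl i u : bil (ev i) u = u (th_opp i) 0 + (i == o)%:R * u o 0.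
Proof.
rewrite /bil (bigD1 i) //= big1 ?addr0 => [|k ki]; last first.
  by rewrite !mxE (negPf ki) mul0r.
by rewrite !mxE !eqxx mul1r eq_sym andbT.
Qed.

Lemma bil_ev_hb i u : i \in hb n -> bil (ev i) u = u (th_opp i) 0.
Proof. by rewrite hbE bil_evl => /negPf ->; rewrite mul0r addr0. Qed.

Lemma bil_ev0 u : bil (ev o) u = 2%:R * u o 0.
Proof. by rewrite bil_evl eqxx th_opp0 mul1r; ring. Qed.

Lemma bil_self u : bil u u = 2%:R * Q u.
Proof.
have := quadQD u (- u).
rewrite subrr bilNr quadQN -(scale0r u) quadQZ expr0n mul0r => E.
by rewrite -[RHS]subr0 [in RHS]E; ring.
Qed.

Lemma ev_entry i k : ev i k 0 = (k == i)%:R.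
Proof. by rewrite mxE eqxx andbT. Qed.

Lemma vec_decomposition v : v = \sum_i v i 0 *: ev i.
Proof.
apply/colP => k; rewrite summxE (bigD1 k) //= big1 ?addr0 => [|i ik].
  by rewrite mxE ev_entry eqxx mulr1.
by rewrite mxE ev_entry eq_sym (negPf ik) mulr0.
Qed.

Lemma mulmx_ev A i k : (A *m ev i) k 0 = A k i.
Proof. by rewrite -colE mxE. Qed.

Lemma matrix_ext A (B : Mat) : (forall w : V, A *m w = B *m w) -> A = B.
Proof. by move=> AB; apply/matrixP => i j; rewrite -!mulmx_ev AB. Qed.

Lemma mulmx_mul A (B : Mat) w : (A * B) *m w = A *m (B *m w).
Proof. by rewrite mulmxA. Qed.

Definition bilr u : 'rV[R]_n.*2.+1 :=
  \row_m (u (th_opp m) 0 + (m == o)%:R * u o 0).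

Lemma bilrE u w : bilr u *m w = (bil u w)%:M.
Proof.
apply/rowP => a; rewrite !ord1 !mxE eqxx mulr1n bilC /bil.
under eq_bigr do rewrite mxE mulrDl.
rewrite big_split /=; congr (_ + _).
  by apply: eq_bigr => i _; rewrite mulrC.
rewrite (bigD1 o) //= big1 ?addr0 => [|k ko]; first by rewrite eqxx mul1r mulrC.
by rewrite (negPf ko) !mul0r.
Qed.

(* The Eichler-Siegel transvection; it is an isometry when u is isotropic and *)
(* orthogonal to v.                                                           *)
Definition esd u v : Mat :=
  1 + u *m bilr v - v *m bilr u - Q v *: (u *m bilr u).

Lemma esdE u v w : esd u v *m w =
  w + bil v w *: u - bil u w *: v - (Q v * bil u w) *: u.
Proof.
rewrite /esd !mulmxBl mulmxDl mul1mx -!scalemxAl -!mulmxA !bilrE !mul_mx_scalar.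
by rewrite scalerA.
Qed.

Definition bil_simp := (bilDl, bilDr, bilNl, bilNr, bilZl, bilZr,
  quadQD, quadQN, quadQZ).

Lemma bil_ev_ev i j : i \in hb n -> bil (ev i) (ev j) = (th_opp i == j)%:R.
Proof. by move=> hi; rewrite bil_ev_hb // ev_entry. Qed.

Lemma bil_ev_ev0 i j : i \in hb n -> i != th_opp j -> bil (ev i) (ev j) = 0.
Proof. by move=> hi ij; rewrite bil_ev_ev // th_opp_eq (negPf ij). Qed.

Lemma bil_ev_opp i : i \in hb n -> bil (ev i) (ev (th_opp i)) = 1.
Proof. by move=> hi; rewrite bil_ev_ev // eqxx. Qed.

Lemma bil_opp_ev i : i \in hb n -> bil (ev (th_opp i)) (ev i) = 1.
Proof. by move=> hi; rewrite bilC bil_ev_opp. Qed.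

Lemma quadQ_hb i : i \in hb n -> Q (ev i) = 0.
Proof. by rewrite hbE quadQ_ev => /negPf ->. Qed.

Lemma bil_ev_self i : i \in hb n -> bil (ev i) (ev i) = 0.
Proof. by move=> hi; rewrite bil_self quadQ_hb ?mulr0. Qed.

Lemma bil_evo i : i \in hb n -> bil (ev i) (ev o) = 0.
Proof.
move=> hi; rewrite bil_ev_ev // th_opp_eq0.
by move: hi; rewrite hbE => /negPf ->.
Qed.

(** * Isometries and relations between transvections *)

Definition q_isometry A := forall u, Q (A *m u) = Q u.

Lemma isometry_bil A u v : q_isometry A -> bil (A *m u) (A *m v) = bil u v.
Proof.
move=> hA; have := hA (u + v); rewrite mulmxDr !quadQD !hA.
exact: addrI.
Qed.

Lemma isometry_inverse A A' : q_isometry A -> inverse_mx A A' -> q_isometry A'.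
Proof.
by move=> hA [AA' _] u; rewrite -hA -mulmx_mul AA' mul1mx.
Qed.

Lemma isometry_mul A (B : Mat) :
  q_isometry A -> q_isometry B -> q_isometry (A * B).
Proof. by move=> hA hB u; rewrite mulmx_mul hA hB. Qed.

Lemma isometry_conj A (B B' : Mat) : q_isometry A -> q_isometry B ->
  inverse_mx B B' -> q_isometry (B * A * B').
Proof.
move=> hA hB BB'; apply: isometry_mul; first exact: isometry_mul.
exact: isometry_inverse BB'.
Qed.

Lemma esd_isometry u v : Q u = 0 -> bil u v = 0 -> q_isometry (esd u v).
Proof.
move=> Qu uv w.
rewrite esdE !bil_simp Qu uv ![bil w _]bilC (bilC v u) uv bil_self Qu.
ring.
Qed.

Lemma esd_mul u v w : Q u = 0 -> bil u v = 0 -> bil u w = 0 ->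
  esd u v * esd u w = esd u (v + w).
Proof.
move=> Qu uv uw; apply: matrix_ext => z; rewrite mulmx_mul !esdE !bil_simp.
rewrite bil_self Qu uw ?(bilC v u) ?uv.
by apply/colP => a; rewrite !mxE; ring.
Qed.

(** The terms x B(u, w) u coming from B(v + x u, w) u and from B(u, w) (v + x u) cancel, and Q(v + x
    u) = Q(v). *)
Lemma esd_addZ u v x : Q u = 0 -> bil u v = 0 -> esd u (v + x *: u) = esd u v.
Proof.
move=> Qu uv; apply: matrix_ext => z; rewrite !esdE !bil_simp.
rewrite Qu ?(bilC v u) ?uv.
by apply/colP => a; rewrite !mxE; ring.
Qed.

Lemma esd0 u : esd u 0 = 1.
Proof.
apply: matrix_ext => w; rewrite esdE mul1mx -(scale0r u) !bil_simp.
by apply/colP => a; rewrite !mxE; ring.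
Qed.

(** Without the quadratic term, E(u, v) w - w is alternating in u and v. *)
Lemma esd_swap u v : Q u = 0 -> Q v = 0 -> esd u v = esd v (- u).
Proof.
move=> Qu Qv; apply: matrix_ext => w; rewrite !esdE !bil_simp Qu Qv.
by apply/colP => a; rewrite !mxE; ring.
Qed.

Lemma esdN u v : esd (- u) (- v) = esd u v.
Proof.
apply: matrix_ext => w; rewrite !esdE !bil_simp.
by apply/colP => a; rewrite !mxE; ring.
Qed.

Lemma esd_inverse u v : Q u = 0 -> bil u v = 0 ->
  inverse_mx (esd u v) (esd u (- v)).
Proof.
by move=> Qu uv; split; rewrite esd_mul ?bilNr ?uv ?oppr0 // ?subrr ?addNr esd0.
Qed.

Lemma esd_conj A A' u v : q_isometry A -> inverse_mx A A' ->
  A * esd u v * A' = esd (A *m u) (A *m v).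
Proof.
move=> hA AA'; apply: matrix_ext => w; rewrite !mulmx_mul !esdE hA.
have E z : bil (A *m z) w = bil z (A' *m w).
  by rewrite -(isometry_bil z _ hA) -mulmx_mul AA'.1 mul1mx.
by rewrite !E !(mulmxDr, mulmxN) -!scalemxAr -mulmx_mul AA'.1 mul1mx.
Qed.

(** * Root elements as transvections, and the elementary subgroup *)

Lemma mul_delta_mx_vec i j w : delta_mx i j *m w = w j 0 *: ev i.
Proof.
apply/colP => a; rewrite !mxE (bigD1 j) //= big1 ?addr0 => [|b bj].
  by rewrite !mxE !eqxx !andbT mulrC.
by rewrite !mxE (negPf bj) andbF mul0r.
Qed.

Lemma TlE k l x : k \in hb n -> l \in hb n ->
  Tl k l x = esd (ev k) (x *: ev (th_opp l)).
Proof.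
move=> hk hl; apply: matrix_ext => w.
rewrite esdE !mulmxBl mulmxDl mul1mx -!scalemxAl !mul_delta_mx_vec !bil_simp.
rewrite !bil_ev_hb ?hb_opp // quadQ_hb ?hb_opp // th_oppK.
by apply/colP => a; rewrite !mxE; ring.
Qed.

Lemma TsE k x : k \in hb n -> Ts k x = esd (ev k) (- x *: ev o).
Proof.
move=> hk; apply: matrix_ext => w.
rewrite esdE !mulmxBl mulmxDl mul1mx -!scalemxAl !mul_delta_mx_vec !bil_simp.
rewrite !(bil_ev_hb _ hk) bil_ev0 quadQ_ev eqxx mulr1.
by apply/colP => a; rewrite !mxE; ring.
Qed.

Lemma EO_esd_long k m x : k \in hb n -> m \in hb n -> distinct_pairs k m ->
  EO (esd (ev k) (x *: ev m)).
Proof.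
move=> hk hm; rewrite -(th_oppK m) -TlE ?hb_opp // th_oppK.
rewrite distinct_pairsC -distinct_pairs_oppl distinct_pairsC => /andP [km km'].
by apply: EO_long; rewrite ?hb_opp.
Qed.

Lemma EO_esd_short k x : k \in hb n -> EO (esd (ev k) (x *: ev o)).
Proof. by move=> hk; rewrite -(opprK x) -TsE //; apply: EO_short. Qed.

(** E(e_k, v) is split along the coordinates of [v]. The one at k acts trivially and the one at -k
    is B(e_k, v) = 0, so only root elements remain. *)
Lemma esd_ev_ind (P : Mat -> Prop) k v : k \in hb n -> bil (ev k) v = 0 ->
  P 1 -> (forall A (B : Mat), P A -> P B -> P (A * B)) ->
  (forall m, m \in hb n -> distinct_pairs k m ->
     P (esd (ev k) (v m 0 *: ev m))) ->
  P (esd (ev k) (v o 0 *: ev o)) ->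
  P (esd (ev k) v).
Proof.
move=> hk kv P1 PM Pl P0; rewrite (vec_decomposition v).
suff: P (esd (ev k) (\sum_i v i 0 *: ev i)) /\
  bil (ev k) (\sum_i v i 0 *: ev i) = 0 by case.
elim/big_rec: _ => [|i u _ [Pu ku]]; first by rewrite esd0 bil0r.
have ki : bil (ev k) (v i 0 *: ev i) = 0.
  rewrite bil_simp bil_ev_ev //; case: eqP => [E|]; last by rewrite mulr0.
  by rewrite -E -bil_ev_hb // kv mul0r.
rewrite bilDr ki ku addr0 -esd_mul ?quadQ_hb //; split=> //.
apply: PM => //.
case: (eqVneq i o) => [-> //|io].
case: (eqVneq k i) => [<-|ik].
  by rewrite -[_ *: _]add0r esd_addZ ?quadQ_hb ?bil0r // esd0.
case: (eqVneq k (th_opp i)) => [E|ik'].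
  move: ki; rewrite E bil_simp bil_opp_ev ?hbE // mulr1 => ->.
  by rewrite scale0r esd0.
by apply: Pl; rewrite ?hbE // /distinct_pairs ik ik'.
Qed.

Lemma EO_esd k v : k \in hb n -> bil (ev k) v = 0 -> EO (esd (ev k) v).
Proof.
move=> hk kv; apply: esd_ev_ind => //.
- exact: EO_one.
- by move=> A B; apply: EO_mul.
- by move=> m hm km; apply: EO_esd_long.
- exact: EO_esd_short.
Qed.

Lemma bil_ev_distinct k m : k \in hb n -> distinct_pairs k m ->
  bil (ev k) (ev m) = 0.
Proof. by move=> hk /andP [_ km]; rewrite bil_ev_ev0. Qed.

Lemma EO_inverse A : EO A -> exists2 A', EO A' & inverse_mx A A'.
Proof.
elim=> {A} [i j x hi hj ij ij'|i x hi||
  A B _ [A' EA AA'] _ [B' EB BB']|A B EA _ AB].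
- rewrite TlE // ; exists (esd (ev i) (- (x *: ev (th_opp j)))).
    by rewrite -scaleNr -TlE //; apply: EO_long.
  apply: esd_inverse; rewrite ?quadQ_hb // bilZr bil_ev_ev0 ?mulr0 //.
  by rewrite th_oppK.
- rewrite TsE //; exists (esd (ev i) (- (- x *: ev o))).
    by rewrite -scaleNr -TsE //; apply: EO_short.
  by apply: esd_inverse; rewrite ?quadQ_hb // bilZr bil_evo ?mulr0.
- by exists 1; [apply: EO_one | apply: inverse_mx1].
- by exists (B' * A'); [apply: EO_mul | apply: inverse_mx_mul].
- by exists A; last exact: inverse_mx_sym.
Qed.

Lemma EO_isometry A : EO A -> q_isometry A.
Proof.
elim=> {A} [i j x hi hj ij ij'|i x hi||A B _ hA _ hB|A B EA hA AB].
- rewrite TlE //; apply: esd_isometry; rewrite ?quadQ_hb //.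
  by rewrite bilZr bil_ev_ev0 ?mulr0 // th_oppK.
- rewrite TsE //; apply: esd_isometry; rewrite ?quadQ_hb //.
  by rewrite bilZr bil_evo ?mulr0.
- by move=> u; rewrite mul1mx.
- exact: isometry_mul.
- exact: isometry_inverse AB.
Qed.

(** * Products of elementary conjugates *)

Section Products.

Variables (sigma sigma' : Mat).
Hypothesis sigmaV : inverse_mx sigma sigma'.

Local Notation H := (product_of_conjugates sigma).

Lemma product_of_conjugatesP N A : H N A <->
  exists s : seq Mat, [/\ size s = N,
    forall B : Mat, B \in s -> elementary_conjugate sigma B
    & A = \prod_(B <- s) B].
Proof.
split=> [[s [hs ->]]|[s [ss hs ->]]]; first by exists s; rewrite size_tuple.
by move/eqP in ss; exists (Tuple ss).
Qed.

Lemma conjprod_mul N M A (B : Mat) : H N A -> H M B -> H (N + M) (A * B).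
Proof.
rewrite !product_of_conjugatesP => -[s [<- hs ->]] [t [<- ht ->]].
exists (s ++ t); rewrite size_cat big_cat; split=> // C.
by rewrite mem_cat => /orP [/hs|/ht].
Qed.

Lemma conjprod0 : H 0 1.
Proof. by apply/product_of_conjugatesP; exists [::]; rewrite big_nil. Qed.

Lemma conjprod1 A : elementary_conjugate sigma A -> H 1 A.
Proof.
move=> hA; apply/product_of_conjugatesP; exists [:: A].
by rewrite big_seq1; split=> // B; rewrite inE => /eqP ->.
Qed.

Lemma elementary_conjugate_EO A (B B' : Mat) : EO B -> inverse_mx B B' ->
  elementary_conjugate sigma A -> elementary_conjugate sigma (B * A * B').
Proof.
move=> EB BB' [e [e' [t [Ee ee' ht ->]]]]; exists (B * e), (e' * B'), t.
by rewrite !mulrA; split=> //; [apply: EO_mul | apply: inverse_mx_mul].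
Qed.

Lemma conjprod_conj N A (B B' : Mat) : EO B -> inverse_mx B B' ->
  H N A -> H N (B * A * B').
Proof.
move=> EB BB' /product_of_conjugatesP [s [<- hs ->]] {N A}.
elim: s hs => [|A s IHs] hs.
  by rewrite big_nil mulr1 BB'.1; exact: conjprod0.
rewrite big_cons.
have -> : B * (A * \prod_(j <- s) j) * B' =
  (B * A * B') * (B * (\prod_(j <- s) j) * B').
  by rewrite !mulrA -[_ * B' * B]mulrA BB'.2 mulr1.
apply: (@conjprod_mul 1); last first.
  by apply: IHs => C Cs; apply: hs; rewrite inE Cs orbT.
by apply/conjprod1/elementary_conjugate_EO => //; apply: hs; rewrite mem_head.
Qed.

Lemma elementary_conjugate_inv A : elementary_conjugate sigma A ->
  exists2 A', elementary_conjugate sigma A' & inverse_mx A A'.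
Proof.
move=> [e [e' [t [Ee ee' ht ->]]]].
have [t' ht' tt'] : exists2 t',
    t' = sigma \/ inverse_mx sigma t' & inverse_mx t t'.
  case: ht => [->|st]; first by exists sigma'; first right.
  by exists sigma; [left | apply: inverse_mx_sym].
exists (e * t' * e'); first by exists e, e', t'.
rewrite -[e * t' * e']mulrA.
exact: inverse_mx_mul (inverse_mx_mul ee' tt') (inverse_mx_sym ee').
Qed.

(** The factors are inverted and their order is reversed; both exponents of sigma being allowed, the
    inverse of a conjugate is a conjugate. *)
Lemma conjprod_inv N A A' : inverse_mx A A' -> H N A -> H N A'.
Proof.
move=> AA' /product_of_conjugatesP [s [ss hs EA]].
have [B HB AB] : exists2 B, H N B & inverse_mx A B.
  rewrite EA -ss {N A A' AA' ss EA}.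
  elim: s hs => [|A s IHs] hs.
    by rewrite big_nil; exists 1; [apply: conjprod0 | apply: inverse_mx1].
  have [B HB sB] : exists2 B, H (size s) B & inverse_mx (\prod_(C <- s) C) B.
    by apply: IHs => C Cs; apply: hs; rewrite inE Cs orbT.
  have [A' hA' AA'] := elementary_conjugate_inv (hs A (mem_head _ _)).
  exists (B * A'); last by rewrite big_cons; apply: inverse_mx_mul.
  by rewrite /= -addn1; apply: conjprod_mul => //; apply: conjprod1.
by rewrite (inverse_mx_uniq AA' AB).
Qed.

Lemma elementary_conjugate_self : elementary_conjugate sigma sigma.
Proof.
exists 1, 1, sigma; rewrite mul1r mulr1.
by split=> //; [apply: EO_one | apply: inverse_mx1 | left].
Qed.

(* Since 1 = sigma sigma^-1, only an upper bound of the right parity matters. *)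
Lemma conjprod_even N : H N.*2 1.
Proof.
elim: N => [|N IH]; first exact: conjprod0.
rewrite doubleS -addn2 -[1]mulr1; apply: conjprod_mul => //.
rewrite -sigmaV.1; apply: (@conjprod_mul 1 1); apply: conjprod1.
  exact: elementary_conjugate_self.
have [B hB sB] := elementary_conjugate_inv elementary_conjugate_self.
by rewrite (inverse_mx_uniq sigmaV sB).
Qed.

Lemma conjprod_pad N M A : (N <= M)%N -> odd N = odd M -> H N A -> H M A.
Proof.
move=> NM oNM HA; rewrite -[A]mulr1 -(subnKC NM); apply: conjprod_mul => //.
have -> : (M - N = ((M - N)./2).*2)%N.
  by rewrite even_halfK // oddB // oNM addbb.
exact: conjprod_even.
Qed.

(** The commutator is A times B A^-1 B^-1, two products of N conjugates. *)
Lemma conjprod_commutator N A A' (B B' : Mat) : inverse_mx A A' ->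
  EO B -> inverse_mx B B' -> H N A -> H (N + N) (A * B * A' * B').
Proof.
move=> AA' EB BB' HA; rewrite -!mulrA; apply: conjprod_mul => //.
by rewrite mulrA; apply: conjprod_conj => //; apply: conjprod_inv HA.
Qed.

End Products.

(** Since e (B sigma B^-1) e^-1 = (e B) sigma (e B)^-1, bounds proved for an elementary conjugate of
    sigma hold for sigma. *)
Lemma conjprod_change (sigma sigma' B B' : Mat) N A :
  inverse_mx sigma sigma' -> EO B -> inverse_mx B B' ->
  product_of_conjugates (B * sigma * B') N A -> product_of_conjugates sigma N A.
Proof.
move=> ss' EB BB' [s [hs ->]]; exists s; split=> // C /hs.
move=> [e [e' [t [Ee ee' ht ->]]]].
exists (e * B), (B' * e').
have H t' : B * t' * B' = t -> t' = sigma \/ inverse_mx sigma t' ->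
  exists tau, [/\ EO (e * B), inverse_mx (e * B) (B' * e'),
    tau = sigma \/ inverse_mx sigma tau & e * t * e' = e * B * tau * (B' * e')].
  move=> <- ht'; exists t'; rewrite !mulrA.
  by split=> //; [apply: EO_mul | rewrite -?mulrA; apply: inverse_mx_mul].
case: ht => ht; first by apply: (H sigma); [rewrite ht | left].
apply: (H sigma'); last by right.
apply: inverse_mx_uniq ht; rewrite -[B * sigma' * B']mulrA.
exact: inverse_mx_mul (inverse_mx_mul BB' ss') (inverse_mx_sym BB').
Qed.

Lemma esd_fix u v w : bil u w = 0 -> bil v w = 0 -> esd u v *m w = w.
Proof. by move=> uw vw; rewrite esdE uw vw mulr0 !scale0r !subr0 addr0. Qed.

Lemma esd_scale u v x : Q v = 0 -> esd (x *: u) v = esd u (x *: v).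
Proof.
move=> Qv; apply: matrix_ext => w; rewrite !esdE !bil_simp Qv.
by apply/colP => a; rewrite !mxE; ring.
Qed.

Lemma bil_distinct k m : k \in hb n -> m \in hb n -> distinct_pairs k m ->
  let k' := th_opp k in let m' := th_opp m in
  (bil (ev k) (ev m) = 0) * (bil (ev k) (ev m') = 0) *
  (bil (ev k') (ev m) = 0) * (bil (ev k') (ev m') = 0) *
  (bil (ev m) (ev k) = 0) * (bil (ev m') (ev k) = 0) *
  (bil (ev m) (ev k') = 0) * (bil (ev m') (ev k') = 0).
Proof.
move=> hk hm km /=; rewrite ![bil (ev m) _]bilC ![bil (ev (th_opp m)) _]bilC.
by do 7!(split; [|rewrite ?bil_ev_distinct ?distinct_pairs_oppl
  ?distinct_pairs_oppr ?hb_opp //]); rewrite bil_ev_distinct.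
Qed.

Lemma bil_hyperbolic k : k \in hb n -> let k' := th_opp k in
  (bil (ev k) (ev k) = 0) * (bil (ev k') (ev k') = 0) *
  (bil (ev k) (ev k') = 1) * (bil (ev k') (ev k) = 1) *
  (Q (ev k) = 0) * (Q (ev k') = 0) *
  (bil (ev k) (ev o) = 0) * (bil (ev k') (ev o) = 0) *
  (bil (ev o) (ev k) = 0) * (bil (ev o) (ev k') = 0).
Proof.
move=> hk /=; rewrite ![bil (ev o) _]bilC.
by rewrite !bil_ev_self ?bil_ev_opp ?bil_opp_ev ?quadQ_hb ?bil_evo ?hb_opp.
Qed.

(** The right factor of the witness sends e_k to e_k + e_m, and the left one then subtracts e_k.
    Here [l] may be the zero label. *)
Lemma EO_move k m : k \in hb n -> m \in hb n -> distinct_pairs k m ->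
  exists A A' : Mat, [/\ EO A, inverse_mx A A', A *m ev k = ev m
    & forall l, distinct_pairs l k -> distinct_pairs l m -> A *m ev l = ev l].
Proof.
move=> hk hm km; pose k' := th_opp k; pose m' := th_opp m.
have Fd := bil_distinct hk hm km; have Fk := bil_hyperbolic hk.
have Fm := bil_hyperbolic hm.
have EA : EO (esd (ev k) (- ev m') * esd (ev m) (ev k')).
  by apply: EO_mul; apply: EO_esd => //; rewrite ?bil_simp ?Fd ?oppr0.
have [A' EA' AA'] := EO_inverse EA.
exists (esd (ev k) (- ev m') * esd (ev m) (ev k')), A'; split=> //.
  rewrite mulmx_mul !esdE !bil_simp !Fd !Fk !Fm.
  by apply/colP => a; rewrite !mxE; ring.
move=> l lk lm; rewrite mulmx_mul.
have F p : p \in hb n -> distinct_pairs l p -> bil (ev p) (ev l) = 0.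
  by move=> hp lp; rewrite bil_ev_distinct // distinct_pairsC.
rewrite (@esd_fix _ (ev k')) ?F // ?hb_opp // ?distinct_pairs_oppr //.
by rewrite esd_fix ?bilNl ?F ?oppr0 // ?hb_opp // ?distinct_pairs_oppr.
Qed.

(** * Off-diagonal entries *)

Section Orthogonal.

Hypothesis n3 : (3 <= n)%N.
Variables (sigma sigma' : Mat).
Hypothesis sigmaV : inverse_mx sigma sigma'.
Hypothesis sigmaQ : q_isometry sigma.

Local Notation H := (product_of_conjugates sigma).

(** Conjugation by the element of [EO_move], which fixes e_m. As [m] may be the zero label, this
    serves long and short root elements alike. *)
Lemma conjprod_move N k p m y : k \in hb n -> p \in hb n ->
  distinct_pairs m k -> distinct_pairs m p ->
  H N (esd (ev k) (y *: ev m)) -> H N (esd (ev p) (y *: ev m)).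
Proof.
move=> hk hp; wlog kp : k p hk hp / distinct_pairs k p => [IH mk mp Hk|].
  have [kp|] := boolP (distinct_pairs k p); first exact: IH Hk.
  (* When p is k or -k, the move passes through a third index. *)
  have [c [hc ck cm]] := exists_third_index k m n3.
  have mc : distinct_pairs m c by rewrite distinct_pairsC.
  rewrite negb_and !negbK => kp.
  have cp : distinct_pairs c p.
    by case/orP: kp ck => /eqP ->; rewrite ?distinct_pairs_oppr.
  apply: (IH c) => //; apply: (IH k) => //; by rewrite distinct_pairsC.
move=> mk mp; have [A [A' [EA AA' Akp Am]]] := EO_move hk hp kp.
move=> /(conjprod_conj EA AA'); rewrite (esd_conj _ _ (EO_isometry EA) AA').
by rewrite -scalemxAr (Am m) // Akp.
Qed.

(** E(e_k, y e_m) = E(y e_k, e_m) = E(e_m, - y e_k), the inverse of the target. *)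
Lemma conjprod_swap N k m y : k \in hb n -> m \in hb n -> distinct_pairs k m ->
  H N (esd (ev k) (y *: ev m)) -> H N (esd (ev m) (y *: ev k)).
Proof.
move=> hk hm km; have Fd := bil_distinct hk hm km.
have [Qk Qm] := (quadQ_hb hk, quadQ_hb hm).
apply: (conjprod_inv sigmaV).
rewrite -esd_scale // esd_swap ?quadQZ ?Qk ?Qm ?mulr0 //.
apply: inverse_mx_sym; apply: esd_inverse => //.
by rewrite bilZr Fd mulr0.
Qed.

(** Quantifying over all long roots reduces later arguments to arithmetic on [y]. *)
Definition conjprod_long N y := forall k m, k \in hb n -> m \in hb n ->
  distinct_pairs k m -> H N (esd (ev k) (y *: ev m)).

Lemma conjprod_longI N k m y : k \in hb n -> m \in hb n -> distinct_pairs k m ->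
  H N (esd (ev k) (y *: ev m)) -> conjprod_long N y.
Proof.
move=> hk hm km Hkm p q hp hq pq.
wlog pm : k m hk hm km Hkm / distinct_pairs p m => [IH|].
  have [|] := boolP (distinct_pairs p m); first exact: IH Hkm.
  rewrite negb_and !negbK => pm.
  (* When p is m or -m the direct move is impossible, so [m] is first replaced by [c]. *)
  have [c [hc ck cm]] := exists_third_index k m n3.
  apply: (IH k c) => //; first by rewrite distinct_pairsC.
    apply: conjprod_swap; rewrite // ?(distinct_pairsC c) //.
    apply: (@conjprod_move _ m) => //; first by rewrite distinct_pairsC.
    exact: conjprod_swap.
  by case/orP: pm cm => /eqP ->; rewrite distinct_pairsC ?distinct_pairs_oppl.
apply: conjprod_swap; rewrite // 1?distinct_pairsC //.
apply: (@conjprod_move _ m) => //.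
apply: conjprod_swap => //; apply: (@conjprod_move _ k) => //;
  by rewrite distinct_pairsC.
Qed.

Lemma conjprod_longD N M x y : conjprod_long N x -> conjprod_long M y ->
  conjprod_long (N + M) (x + y).
Proof.
move=> Hx Hy k m hk hm km.
rewrite scalerDl -esd_mul ?quadQ_hb ?bilZr ?bil_ev_distinct ?mulr0 //.
by apply: conjprod_mul; [apply: Hx | apply: Hy].
Qed.

Lemma conjprod_longN N x : conjprod_long N x -> conjprod_long N (- x).
Proof.
move=> Hx k m hk hm km; apply: (conjprod_inv sigmaV) (Hx k m hk hm km).
rewrite scaleNr; apply: esd_inverse; first exact: quadQ_hb.
by rewrite bilZr bil_ev_distinct ?mulr0.
Qed.

Lemma conjprod_longB N M x y : conjprod_long N x -> conjprod_long M y ->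
  conjprod_long (N + M) (x - y).
Proof. by move=> Hx /conjprod_longN; apply: conjprod_longD. Qed.

Lemma conjprod_long_pad N M x : (N <= M)%N -> odd N = odd M ->
  conjprod_long N x -> conjprod_long M x.
Proof.
move=> NM oNM Hx k m hk hm km; apply: (conjprod_pad sigmaV NM) => //.
exact: Hx.
Qed.

(** * The element rho attached to the i-th row, and off-diagonal entries *)

Section RowFixing.

Variables i j c : I.
Hypotheses (hi : i \in hb n) (hj : j \in hb n) (hc : c \in hb n).
Hypotheses (ij : distinct_pairs i j) (ci : distinct_pairs c i)
  (cj : distinct_pairs c j).

Local Notation f := (sigma i).
Local Notation i' := (th_opp i).
Local Notation c' := (th_opp c).
Local Notation j' := (th_opp j).

Let frame := (bil_distinct hi hj ij, bil_distinct hc hi ci,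
  bil_distinct hc hj cj, bil_hyperbolic hi, bil_hyperbolic hj,
  bil_hyperbolic hc).

(** With u^v standing for E(u, v), [tau1] carries the term of the bivector in e_j^e_c and [tau2] the
    two terms containing e_i. *)
Definition tau1 : Mat := esd (ev j) (f i *: ev c).
Definition tau2 : Mat := esd (ev i) (f c *: ev j - f j *: ev c).
Definition tau : Mat := tau1 * tau2.
Definition tau1' : Mat := esd (ev j) (- (f i *: ev c)).
Definition tau2' : Mat := esd (ev i) (- (f c *: ev j - f j *: ev c)).
Definition tau' : Mat := tau2' * tau1'.
Definition rho : Mat := sigma * tau * sigma'.
Definition rho' : Mat := sigma * tau' * sigma'.

Lemma tau1V : inverse_mx tau1 tau1'.
Proof. by apply: esd_inverse; rewrite ?bil_simp ?frame ?mulr0. Qed.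

Lemma tau2V : inverse_mx tau2 tau2'.
Proof. by apply: esd_inverse; rewrite ?bil_simp ?frame ?mulr0 ?subrr. Qed.

Lemma tauV : inverse_mx tau tau'.
Proof. exact: inverse_mx_mul tau1V tau2V. Qed.

Lemma EO_tau1 : EO tau1.
Proof. by apply: EO_esd => //; rewrite ?bil_simp ?frame ?mulr0. Qed.

Lemma EO_tau2 : EO tau2.
Proof. by apply: EO_esd => //; rewrite ?bil_simp ?frame ?mulr0 ?subrr. Qed.

Lemma EO_tau : EO tau.
Proof. exact: EO_mul EO_tau1 EO_tau2. Qed.

Lemma rhoV : inverse_mx rho rho'.
Proof.
rewrite /rho' -mulrA.
exact: inverse_mx_mul (inverse_mx_mul sigmaV tauV) (inverse_mx_sym sigmaV).
Qed.

Lemma rho_isometry : q_isometry rho.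
Proof.
apply: isometry_mul; last exact: isometry_inverse sigmaV.
by apply: isometry_mul => //; apply/EO_isometry/EO_tau.
Qed.

(** Sigma being an isometry, the linear form f is B(-, sigma^-1 e_-i). *)
Lemma bil_sigmaV_row m : bil (ev m) (sigma' *m ev i') = f m.
Proof.
rewrite -(isometry_bil _ _ sigmaQ) -mulmx_mul sigmaV.1 mul1mx bilC.
by rewrite bil_ev_hb ?hb_opp // th_oppK mulmx_ev.
Qed.

Lemma rho_fix : rho *m ev i' = ev i'.
Proof.
rewrite /rho !mulmx_mul; set p := sigma' *m ev i'.
(* Vanishing contraction: [tau2] adds - f_i (f_c e_j - f_j e_c) to [p], and [tau1] takes it back. *)
have -> : tau1 *m (tau2 *m p) = p.
  rewrite !esdE !bil_simp !bil_sigmaV_row !frame.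
  by apply/colP => a; rewrite !mxE; ring.
by rewrite -mulmx_mul sigmaV.1 mul1mx.
Qed.

(* Since rho fixes ev i', conjugation by rho acts on the abelian unipotent    *)
(* radical attached to ev i', modulo which rho can be traded for t.           *)
Lemma conjprod_radical N (t t' : Mat) v : EO t -> inverse_mx t t' ->
  H N (rho * t') -> bil (ev i') v = 0 ->
  H (N + N) (esd (ev i') (rho *m v) * esd (t *m ev i') (- (t *m v))).
Proof.
move=> Et tt' Hrt iv.
have hi' : i' \in hb n by rewrite hb_opp.
have Eg : EO (esd (ev i') v) by apply: EO_esd.
have gV : inverse_mx (esd (ev i') v) (esd (ev i') (- v)).
  by apply: esd_inverse; rewrite ?quadQ_hb.
have [Et' t'V] : EO t' /\ inverse_mx t' t.
  by split; [apply: EO_inv Et tt' | apply: inverse_mx_sym].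
(* With g = E(e_-i, v), the commutator of rho t^-1 and t g t^-1 collapses to (rho g rho^-1) (t g^-1
   t^-1). *)
have EB : EO (t * esd (ev i') v * t') by do 2?apply: EO_mul.
have BV : inverse_mx (t * esd (ev i') v * t') (t * esd (ev i') (- v) * t').
  rewrite -[t * esd _ (- v) * t']mulrA.
  exact: inverse_mx_mul (inverse_mx_mul tt' gV) t'V.
have := conjprod_commutator sigmaV (inverse_mx_mul rhoV t'V) EB BV Hrt.
rewrite -mulmxN -(esd_conj _ _ (EO_isometry Et) tt').
have <- : rho * esd (ev i') v * rho' = esd (ev i') (rho *m v).
  by rewrite (esd_conj _ _ rho_isometry rhoV) rho_fix.
rewrite !mulrA.
by rewrite -[_ * t' * t]mulrA tt'.2 mulr1 -[_ * t' * t]mulrA tt'.2 mulr1.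
Qed.

Lemma conjprod_rho_tau : H 2 (rho * tau').
Proof.
have -> : rho * tau' = sigma * (tau * sigma' * tau').
  by rewrite /rho !mulrA.
apply: (conjprod_mul (N := 1) (M := 1)); apply: conjprod1.
  exact: elementary_conjugate_self.
exists tau, tau', sigma'; split=> //; [exact: EO_tau | exact: tauV | by right].
Qed.

Lemma conjprod_entry_step r : H 8 (esd (ev i') (r * f j *: ev c)).
Proof.
have hi' : i' \in hb n by rewrite hb_opp.
have Qi' := quadQ_hb hi'.
have rj : bil (ev i') (rho *m ev j) = 0.
  by rewrite -{1}rho_fix (isometry_bil _ _ rho_isometry) !frame.
have := conjprod_radical EO_tau tauV conjprod_rho_tau (v := ev j).
rewrite !frame => /(_ erefl).
have -> : tau *m ev j = ev j.
  by rewrite mulmx_mul !esd_fix ?bil_simp ?frame ?mulr0 ?subrr.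
have -> : tau *m ev i' = ev i' - (f c *: ev j - f j *: ev c).
  rewrite mulmx_mul !esdE !bil_simp !frame.
  by apply/colP => a; rewrite !mxE; ring.
(* E(tau e_-i, - e_j) = E(e_j, tau e_-i), where the e_j-part of tau e_-i drops out. The rest splits
   into E(e_-i, - e_j), absorbed by the first factor, and [s]. *)
rewrite [esd _ (- ev j)]esd_swap ?bil_simp ?frame; last 2 first.
- by ring.
- by [].
rewrite esdN.
have -> : ev i' - (f c *: ev j - f j *: ev c) =
  (ev i' + f j *: ev c) + (- f c) *: ev j.
  by apply/colP => a; rewrite !mxE; ring.
rewrite esd_addZ ?bil_simp ?frame ?mulr0 ?addr0 //.
rewrite -esd_mul ?bil_simp ?frame ?mulr0 //.
rewrite [esd (ev j) (ev i')]esd_swap ?frame // mulrA.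
rewrite esd_mul ?bil_simp ?frame ?oppr0 //.
set y := rho *m ev j - ev j; set s := esd (ev j) _.
have iy : bil (ev i') y = 0 by rewrite bil_simp rj bil_simp !frame subr0.
have sV : inverse_mx s (esd (ev j) (- (f j *: ev c))).
  by apply: esd_inverse; rewrite ?bil_simp ?frame ?mulr0.
have sQ : q_isometry s.
  by apply: esd_isometry; rewrite ?bil_simp ?frame ?mulr0.
(* In the second commutator E(e_-i, y) commutes with E(e_-i, - r e_-j), so only [s] matters: it adds
   r f_j e_c to - r e_-j. The count went from 2 to 4 and now to 8. *)
have ij' : bil (ev i') (- r *: ev j') = 0 by rewrite bil_simp !frame mulr0.
have Eh : EO (esd (ev i') (- r *: ev j')) by apply: EO_esd.
have hV := esd_inverse Qi' ij'.
have yV := esd_inverse Qi' iy.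
move/(conjprod_commutator sigmaV (inverse_mx_mul yV sV) Eh hV).
have -> : esd (ev i') y * s * esd (ev i') (- r *: ev j') *
     (esd (ev j) (- (f j *: ev c)) * esd (ev i') (- y)) *
     esd (ev i') (- (- r *: ev j')) =
  esd (ev i') y * (s * esd (ev i') (- r *: ev j') *
     esd (ev j) (- (f j *: ev c))) * esd (ev i') (- y) *
     esd (ev i') (- (- r *: ev j')) by rewrite !mulrA.
rewrite (esd_conj _ _ sQ sV).
have -> : s *m ev i' = ev i'.
  by rewrite esd_fix ?bil_simp ?frame ?mulr0.
have -> : s *m (- r *: ev j') = - r *: ev j' + (r * f j) *: ev c.
  rewrite esdE !bil_simp !frame.
  by apply/colP => a; rewrite !mxE; ring.
rewrite !esd_mul ?bilDr ?bilNr ?ij' ?iy ?bilZr ?frame ?oppr0 ?mulr0 ?addr0 //.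
congr (H 8 (esd _ _)).
by apply/colP => a; rewrite !mxE; ring.
Qed.

End RowFixing.

Lemma conjprod_entry i j r : i \in hb n -> j \in hb n -> distinct_pairs i j ->
  conjprod_long 8 (r * sigma i j).
Proof.
move=> hi hj ij; have [c [hc ci cj]] := exists_third_index i j n3.
apply: (@conjprod_longI _ (th_opp i) c).
- by rewrite hb_opp.
- by [].
- by rewrite distinct_pairs_oppl distinct_pairsC.
- exact: (conjprod_entry_step hi hj).
Qed.

End Orthogonal.

(** * Entries of elementary conjugates of sigma *)

Section Orthogonal.

Hypothesis n3 : (3 <= n)%N.
Variables (sigma sigma' : Mat).
Hypothesis sigmaV : inverse_mx sigma sigma'.
Hypothesis sigmaQ : q_isometry sigma.

Local Notation H := (product_of_conjugates sigma).
Local Notation conjprod_long := (conjprod_long sigma).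

Lemma bil_ev_sigma k m : k \in hb n ->
  bil (ev k) (sigma *m ev m) = sigma (th_opp k) m.
Proof. by move=> hk; rewrite bil_ev_hb // mulmx_ev. Qed.

(** The (p, q) entry of t sigma t^-1 is B(e_-p, t sigma t^-1 e_q), and the isometry t^-1 may be
    applied to both arguments. *)
Lemma conjprod_conj_entry (t t' : Mat) p q r : EO t -> inverse_mx t t' ->
  p \in hb n -> q \in hb n -> distinct_pairs p q ->
  conjprod_long 8 (r * bil (t' *m ev (th_opp p)) (sigma *m (t' *m ev q))).
Proof.
move=> Et tt' hp hq pq.
have -> : bil (t' *m ev (th_opp p)) (sigma *m (t' *m ev q)) =
  (t * sigma * t') p q.
  rewrite -(isometry_bil _ _ (EO_isometry Et)) -mulmx_mul tt'.1 mul1mx.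
  by rewrite bil_ev_hb ?hb_opp // th_oppK -!mulmx_mul -[RHS]mulmx_ev.
have sV := inverse_mx_conj sigmaV tt'.
have sQ := isometry_conj sigmaQ (EO_isometry Et) tt'.
move=> k m hk hm km; apply: (conjprod_change sigmaV Et tt').
exact: (conjprod_entry n3 sV sQ).
Qed.

Local Notation conjprod_entry := (conjprod_entry n3 sigmaV sigmaQ).

Section TwoIndices.

Variables i j : I.
Hypotheses (hi : i \in hb n) (hj : j \in hb n) (ij : distinct_pairs i j).

Local Notation i' := (th_opp i).
Local Notation j' := (th_opp j).

Let frame := (bil_distinct hi hj ij, bil_hyperbolic hi,
  bil_hyperbolic hj).

(** The inverse of the conjugating element fixes e_-i and sends e_j to e_j - e_-i, so the new entry
    is sigma_ij - sigma_{i,-i}. *)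
Lemma conjprod_antidiagonal r : conjprod_long 16 (r * sigma i i').
Proof.
have hi' : i' \in hb n by rewrite hb_opp.
have Et : EO (esd (ev i') (ev j')) by apply: EO_esd; rewrite ?frame.
have tt' : inverse_mx (esd (ev i') (ev j')) (esd (ev i') (- ev j')).
  by apply: esd_inverse; rewrite ?frame.
have := conjprod_conj_entry r Et tt' hi hj ij.
rewrite esd_fix ?bil_simp ?frame ?oppr0 // esdE !bil_simp !frame.
have -> : ev j + -1 *: ev i' - 0 *: - ev j' - (0 * 0) *: ev i' = ev j - ev i'.
  by apply/colP => a; rewrite !mxE; ring.
rewrite mulmxBr !bil_simp !bil_ev_sigma ?hb_opp // th_oppK => He.
have := conjprod_longB sigmaV (conjprod_entry r hi hj ij) He.
by congr (conjprod_long 16 _); ring.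
Qed.

Let short_inverse k : k \in hb n ->
  inverse_mx (esd (ev k) (- ev o)) (esd (ev k) (ev o)).
Proof.
move=> hk; rewrite -{2}[ev o]opprK.
by apply: esd_inverse; rewrite ?quadQ_hb ?bil_simp ?bil_evo ?oppr0.
Qed.

Let EO_short1 k : k \in hb n -> EO (esd (ev k) (- ev o)).
Proof. by move=> hk; apply: EO_esd; rewrite ?bil_simp ?bil_evo ?oppr0. Qed.

(** Here the new entry is sigma_ij - sigma_i0 - sigma_{i,-j}. *)
Lemma conjprod_col0 r : conjprod_long 24 (r * sigma i o).
Proof.
have hj' : j' \in hb n by rewrite hb_opp.
have := conjprod_conj_entry r (EO_short1 hj') (short_inverse hj') hi hj ij.
rewrite esd_fix ?frame // esdE !frame quadQ_ev0.
have -> : ev j + 0 *: ev j' - 1 *: ev o - (1 * 1) *: ev j' =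
  ev j - ev o - ev j'.
  by apply/colP => a; rewrite !mxE; ring.
rewrite !mulmxBr !bil_simp !bil_ev_sigma ?hb_opp // th_oppK => He.
have ij' : distinct_pairs i j' by rewrite distinct_pairs_oppr.
have Hij := conjprod_entry r hi hj ij; have Hij' := conjprod_entry r hi hj' ij'.
have := conjprod_longB sigmaV (conjprod_longB sigmaV Hij Hij') He.
by congr (conjprod_long 24 _); ring.
Qed.

(** Now e_-i is moved, to e_-i - e_0 - e_i; pairing with e_0 doubles the zero coordinate, hence the
    factor 2. *)
Lemma conjprod_row0 r : conjprod_long 24 (r * (2%:R * sigma o j)).
Proof.
have := conjprod_conj_entry r (EO_short1 hi) (short_inverse hi) hi hj ij.
rewrite (esd_fix (w := ev j)) ?frame // esdE !frame quadQ_ev0.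
have -> : ev i' + 0 *: ev i - 1 *: ev o - (1 * 1) *: ev i =
  ev i' - ev o - ev i.
  by apply/colP => a; rewrite !mxE; ring.
rewrite !bil_simp bil_ev0 !bil_ev_sigma ?hb_opp // th_oppK mulmx_ev => He.
have hi' : i' \in hb n by rewrite hb_opp.
have i'j : distinct_pairs i' j by rewrite distinct_pairs_oppl.
have Hij := conjprod_entry r hi hj ij; have Hi'j := conjprod_entry r hi' hj i'j.
have := conjprod_longB sigmaV (conjprod_longB sigmaV Hij Hi'j) He.
by congr (conjprod_long 24 _); ring.
Qed.

(** The new entry is sigma_ij - sigma_ii + sigma_jj - sigma_ji. *)
Lemma conjprod_diagonal r : conjprod_long 24 (r * (sigma i i - sigma j j)).
Proof.
have Et : EO (esd (ev i) (ev j')) by apply: EO_esd; rewrite ?frame.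
have tt' : inverse_mx (esd (ev i) (ev j')) (esd (ev i) (- ev j')).
  by apply: esd_inverse; rewrite ?frame.
have := conjprod_conj_entry r Et tt' hi hj ij.
rewrite !esdE !bil_simp !frame.
have -> : ev j + -1 *: ev i - 0 *: - ev j' - (0 * 0) *: ev i = ev j - ev i.
  by apply/colP => a; rewrite !mxE; ring.
rewrite !mulmxBr !bil_simp !bil_ev_sigma ?hb_opp // !th_oppK => He.
have ji : distinct_pairs j i by rewrite distinct_pairsC.
have Hij := conjprod_entry r hi hj ij; have Hji := conjprod_entry r hj hi ji.
have := conjprod_longB sigmaV (conjprod_longB sigmaV Hij Hji) He.
by congr (conjprod_long 24 _); ring.
Qed.

(** Conjugation by E(e_i, t) gives the entry sigma_ij + B(t, sigma e_j) - Q(t) sigma_{-i,j}. The two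
    outer entries must be corrected anyway, so [a] and [b] are free. *)
Lemma conjprod_bil t a b r : bil (ev i) t = 0 -> bil t (ev i') = 0 ->
  bil t (ev j) = 0 ->
  conjprod_long 24
    (r * (bil t (sigma *m ev j) + a * sigma i j + b * sigma i' j)).
Proof.
move=> it ti' tj.
have itV := esd_inverse (quadQ_hb hi) it.
have := conjprod_conj_entry r (EO_esd hi it) itV hi hj ij.
rewrite (esd_fix (w := ev j)) ?frame ?bilNl ?tj ?oppr0 //.
rewrite esdE bilNl ti' oppr0 quadQN !frame !bil_simp !bil_ev_sigma ?hb_opp //.
rewrite th_oppK => He.
have hi' : i' \in hb n by rewrite hb_opp.
have i'j : distinct_pairs i' j by rewrite distinct_pairs_oppl.
have Hij := conjprod_entry (r * (a - 1)) hi hj ij.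
have Hi'j := conjprod_entry (r * (b + Q t)) hi' hj i'j.
have := conjprod_longD (conjprod_longD Hij Hi'j) He.
by congr (conjprod_long 24 _); ring.
Qed.

End TwoIndices.

(** * Short root elements *)

Definition conjprod_short N y := forall k, k \in hb n ->
  H N (esd (ev k) (y *: ev o)).

(** This is [conjprod_move] with the zero label for [m]. *)
Lemma conjprod_shortI N k y : k \in hb n -> H N (esd (ev k) (y *: ev o)) ->
  conjprod_short N y.
Proof.
have o_distinct p : p \in hb n -> distinct_pairs o p.
  rewrite hbE distinct_pairsC /distinct_pairs th_opp0 => ->.
  by [].
by move=> hk Hk p hp; apply: (conjprod_move n3 hk) Hk => //; apply: o_distinct.
Qed.

Lemma conjprod_shortD N M x y : conjprod_short N x -> conjprod_short M y ->
  conjprod_short (N + M) (x + y).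
Proof.
move=> Hx Hy k hk.
rewrite scalerDl -esd_mul ?quadQ_hb ?bilZr ?bil_evo ?mulr0 //.
by apply: conjprod_mul; [apply: Hx | apply: Hy].
Qed.

Lemma conjprod_shortN N x : conjprod_short N x -> conjprod_short N (- x).
Proof.
move=> Hx k hk; apply: (conjprod_inv sigmaV) (Hx k hk).
rewrite scaleNr; apply: esd_inverse; first exact: quadQ_hb.
by rewrite bilZr bil_evo ?mulr0.
Qed.

Lemma conjprod_short_pad N M x : (N <= M)%N -> odd N = odd M ->
  conjprod_short N x -> conjprod_short M x.
Proof.
by move=> NM oNM Hx k hk; apply: (conjprod_pad sigmaV NM) => //; apply: Hx.
Qed.

(* [T_kl(y), T_l(1)] = T_k(y) T_{k,-l}(y), up to signs. *)
Lemma conjprod_short_of_long N y :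
  conjprod_long N y -> conjprod_short (N + N + N) y.
Proof.
move=> Hy k hk; have [l [hl lk _]] := exists_third_index k k n3.
have kl : distinct_pairs k l by rewrite distinct_pairsC.
have hl' : th_opp l \in hb n by rewrite hb_opp.
have frame := (bil_distinct hk hl kl, bil_hyperbolic hk, bil_hyperbolic hl).
have Ee : EO (esd (ev l) (- ev o)).
  by apply: EO_esd; rewrite ?bil_simp ?frame ?oppr0.
have eQ := EO_isometry Ee.
have eV : inverse_mx (esd (ev l) (- ev o)) (esd (ev l) (- - ev o)).
  by apply: esd_inverse; rewrite ?bil_simp ?frame ?oppr0.
have kl' : distinct_pairs k (th_opp l) by rewrite distinct_pairs_oppr.
have AV : inverse_mx (esd (ev k) (- y *: ev (th_opp l)))
    (esd (ev k) (- (- y *: ev (th_opp l)))).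
  by apply: esd_inverse; rewrite ?bil_simp ?frame ?mulr0.
have Hkl' := conjprod_longN sigmaV Hy hk hl' kl'.
have Hcomm := conjprod_commutator sigmaV AV Ee eV Hkl'.
have := conjprod_mul Hcomm (Hy k l hk hl kl).
rewrite -mulrA -mulrA -[_ * (_ * (esd (ev l) _ * _))]mulrA.
rewrite [esd (ev l) (- ev o) * _]mulrA.
rewrite [esd (ev l) (- ev o) * _ * (_ * _)]mulrA (esd_conj _ _ eQ eV).
rewrite (esd_fix (w := ev k)) ?bil_simp ?frame ?oppr0 //.
rewrite -scaleNr -scalemxAr esdE !bil_simp !frame quadQ_ev0.
rewrite !esd_mul ?bil_simp ?frame ?(mulr0, subr0, oppr0, addr0) //.
congr (H _ (esd _ _)).
by apply/colP => a; rewrite !mxE; ring.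
Qed.

(** Each of the 2n nonzero labels is charged N factors. Those at k and -k contribute the identity,
    which is a product of N conjugates because N is even. *)
Lemma conjprod_hb_components N k v : k \in hb n -> bil (ev k) v = 0 ->
  (forall m, m \in hb n -> distinct_pairs k m -> conjprod_long N (v m 0)) ->
  ~~ odd N ->
  H (N * n.*2) (esd (ev k) (\sum_(m in hb n) v m 0 *: ev m)) /\
  bil (ev k) (\sum_(m in hb n) v m 0 *: ev m) = 0.
Proof.
move=> hk kv Hm oN.
have Qk := quadQ_hb hk.
have sz : size (enum (hb n)) = n.*2 by rewrite -cardE cardsC1 card_ord.
rewrite -[X in H (_ * X)]sz.
rewrite -big_enum /=.
have : {subset enum (hb n) <= hb n} by move=> m; rewrite mem_enum.
elim: (enum (hb n)) => [|m s IH] hs /=.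
  by rewrite big_nil muln0 esd0 bil0r; split; first exact: conjprod0.
have hm : m \in hb n by apply: hs; rewrite mem_head.
have [Hs ks] : H (N * size s) (esd (ev k) (\sum_(a <- s) v a 0 *: ev a)) /\
    bil (ev k) (\sum_(a <- s) v a 0 *: ev a) = 0.
  by apply: IH => a sa; apply: hs; rewrite inE sa orbT.
have pad1 : H N 1.
  apply: (conjprod_pad sigmaV (N := 0)) => //; last exact: conjprod0.
  exact/esym/negbTE.
suff [Hkm km] : H N (esd (ev k) (v m 0 *: ev m)) /\
    bil (ev k) (v m 0 *: ev m) = 0.
  rewrite big_cons bilDr km ks addr0 mulnS -esd_mul //; split=> //.
  exact: conjprod_mul.
case: (eqVneq k m) => [<-|km].
  rewrite -[_ *: _]add0r esd_addZ ?bil0r // esd0 add0r.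
  by rewrite bilZr bil_ev_self ?mulr0.
case: (eqVneq k (th_opp m)) => [E|km'].
  have -> : v m 0 = 0 by rewrite -kv bil_ev_hb // E th_oppK.
  by rewrite scale0r esd0 bil0r.
have D : distinct_pairs k m by rewrite /distinct_pairs km.
by split; [apply: Hm | rewrite bilZr bil_ev_distinct ?mulr0].
Qed.

Lemma conjprod_coord0 M N k v : k \in hb n -> bil (ev k) v = 0 ->
  H M (esd (ev k) v) -> ~~ odd N ->
  (forall m, m \in hb n -> distinct_pairs k m -> conjprod_long N (v m 0)) ->
  conjprod_short (M + N * n.*2) (v o 0).
Proof.
move=> hk kv Hv oN Hm.
have [Hs ks] := conjprod_hb_components hk kv Hm oN.
apply: (conjprod_shortI hk).
have Qk := quadQ_hb hk.
have := conjprod_mul Hv (conjprod_inv sigmaV (esd_inverse Qk ks) Hs).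
rewrite esd_mul ?bilNr ?ks ?oppr0 //; congr (H _ (esd _ _)).
rewrite {1}(vec_decomposition v) (bigID (mem (hb n))) /= addrAC subrr add0r.
by rewrite (big_pred1 o) // => m; rewrite hbE negbK.
Qed.

(** * Comparison of rho with [tau1] *)

Section RowFixing.

Variables i j c : I.
Hypotheses (hi : i \in hb n) (hj : j \in hb n) (hc : c \in hb n).
Hypotheses (ij : distinct_pairs i j) (ci : distinct_pairs c i)
  (cj : distinct_pairs c j).

Local Notation f := (sigma i).
Local Notation i' := (th_opp i).
Local Notation c' := (th_opp c).
Local Notation j' := (th_opp j).
Local Notation tau1 := (tau1 sigma i j c).
Local Notation tau1' := (tau1' sigma i j c).
Local Notation tau2 := (tau2 sigma i j c).
Local Notation tau2' := (tau2' sigma i j c).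
Local Notation rho := (rho sigma sigma' i j c).

Let frame := (bil_distinct hi hj ij, bil_distinct hc hi ci,
  bil_distinct hc hj cj, bil_hyperbolic hi, bil_hyperbolic hj,
  bil_hyperbolic hc).

(** rho tau1^-1 = (rho tau^-1) (tau1 tau2 tau1^-1), and [tau2] has the entries f_c and f_j as
    parameters: 18 = 2 + 8 + 8. *)
Lemma conjprod_rho_tau1 : H 18 (rho * tau1').
Proof.
have tau1V := tau1V sigma i hj hc cj.
have tau2V := tau2V sigma hi hj hc ij ci.
have -> : rho * tau1' = rho * tau' sigma i j c * (tau1 * tau2 * tau1').
  rewrite /tau' !mulrA -[_ * tau1' * tau1]mulrA tau1V.2 mulr1.
  by rewrite -[_ * tau2' * tau2]mulrA tau2V.2 mulr1.
apply: (conjprod_mul (N := 2) (M := 16)).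
  exact: (conjprod_rho_tau sigmaV hi hj hc ij ci cj).
apply: (conjprod_conj (EO_tau1 sigma i hj hc cj) tau1V).
have ic : distinct_pairs i c by rewrite distinct_pairsC.
have := conjprod_mul (conjprod_entry 1 hi hc ic hi hj ij)
  (conjprod_entry (-1) hi hj ij hi hc ic).
rewrite esd_mul ?bil_simp ?frame ?mulr0 //; congr (H _ (esd _ _)).
by apply/colP => a; rewrite !mxE; ring.
Qed.

(** Away from the labels j and c, the m-th coordinate is r f_i times the minor of sigma on rows i, m
    and columns i, j. *)
Definition minor_vec r : V := (r * f i) *:
  (f i *: (sigma *m ev j) - f j *: (sigma *m ev i) - (f i * sigma c' c') *: ev j
   + (f i * sigma j' c' - f c' * sigma j' i) *: ev c).

(* The vector of the radical to which rho is applied is                       *)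
(* r (f_i sigma e_-c - f_-c sigma e_i), whose i-th coordinate vanishes.       *)
Lemma conjprod_minor_vec r :
  bil (ev i') (minor_vec r) = 0 /\ H 44 (esd (ev i') (minor_vec r)).
Proof.
have hi' : i' \in hb n by rewrite hb_opp.
pose v := r *: (f i *: (sigma *m ev c') - f c' *: (sigma *m ev i)).
have iv : bil (ev i') v = 0.
  by rewrite !bil_simp !bil_ev_sigma // th_oppK; ring.
have Et := EO_tau1 sigma i hj hc cj.
have tV := tau1V sigma i hj hc cj.
have tQ := EO_isometry Et.
have ti' : tau1 *m ev i' = ev i' by rewrite esd_fix ?bil_simp ?frame ?mulr0.
have rQ := rho_isometry sigmaV sigmaQ hi hj hc ij ci cj.
have rf := rho_fix sigmaV sigmaQ hi hj hc ij ci cj.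
have := conjprod_radical sigmaV sigmaQ hi hj hc ij ci cj Et tV
  conjprod_rho_tau1 iv.
have riv : bil (ev i') (rho *m v) = 0.
  by rewrite -{1}rf (isometry_bil _ _ rQ).
have tiv : bil (ev i') (tau1 *m v) = 0.
  by rewrite -{1}ti' (isometry_bil _ _ tQ).
have i'j : distinct_pairs i' j by rewrite distinct_pairs_oppl.
(* [tau1] applied to [v] leaves an unwanted multiple of e_j with coefficient divisible by the entry
   f_{-c}; removing it gives 44 = 18 + 18 + 8. *)
pose a := r * f i * sigma c' i.
have aj : bil (ev i') ((a * f c') *: ev j) = 0 by rewrite bil_simp !frame mulr0.
have E : minor_vec r = rho *m v - tau1 *m v + (- a * f c') *: ev j.
  (* tau fixes e_i and sends e_-c to e_-c + f_i e_j - f_j e_i. *)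
  have -> : rho *m v =
    r *: (sigma *m (f i *: (ev c' + f i *: ev j - f j *: ev i)
      - f c' *: ev i)).
    have -> : v = r *: (sigma *m (f i *: ev c' - f c' *: ev i)).
      by rewrite mulmxBr -!scalemxAr.
    rewrite -scalemxAr; congr (_ *: _).
    rewrite !mulmx_mul -[sigma' *m _]mulmx_mul sigmaV.2 mul1mx.
    congr (_ *m _); rewrite !esdE !bil_simp !frame.
    by apply/colP => b; rewrite !mxE; ring.
  rewrite esdE !bil_simp !frame !bil_ev_sigma ?hb_opp //.
  rewrite !(mulmxBr, mulmxDr, =^~ scalemxAr) /minor_vec /a.
  by apply/colP => b; rewrite !mxE; ring.
have E' : - a * f c' = - (a * f c') by ring.
rewrite ti' esd_mul ?bilNr ?quadQ_hb ?tiv ?oppr0 // => Hr.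
split; first by rewrite E E' scaleNr !bil_simp riv tiv !frame; ring.
have ic' : distinct_pairs i c' by rewrite distinct_pairs_oppr distinct_pairsC.
have hc' : c' \in hb n by rewrite hb_opp.
have := conjprod_mul Hr (conjprod_entry (- a) hi hc' ic' hi' hj i'j).
rewrite esd_mul ?quadQ_hb -?E //; first by rewrite !bil_simp riv tiv subr0.
by rewrite E' scaleNr bilNr aj oppr0.
Qed.

(** The costly cases are m = j, with the diagonal difference sigma_jj - sigma_{-c,-c} and one entry,
    and m = c, with four entries. The others are padded to 32. *)
Lemma conjprod_minor_coord r m : m \in hb n -> distinct_pairs i' m ->
  conjprod_long 32 (minor_vec r m 0).
Proof.
rewrite distinct_pairs_oppl => hm im.
have mi : distinct_pairs m i by rewrite distinct_pairsC.
have ji : distinct_pairs j i by rewrite distinct_pairsC.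
have jc : distinct_pairs j c by rewrite distinct_pairsC.
have hj' : j' \in hb n by rewrite hb_opp.
have hc' : c' \in hb n by rewrite hb_opp.
have -> : minor_vec r m 0 = r * f i * (f i * sigma m j - f j * sigma m i -
    f i * sigma c' c' * (m == j)%:R +
    (f i * sigma j' c' - f c' * sigma j' i) * (m == c)%:R).
  rewrite /minor_vec -(mulmx_ev sigma j m) -(mulmx_ev sigma i m).
  move: (sigma *m ev j) (sigma *m ev i) => u w.
  by rewrite !mxE !eqxx !andbT.
have Hmi a := conjprod_entry a hm hi mi.
case: (eqVneq m j) => [mj|mj].
  have jc' : distinct_pairs j c' by rewrite distinct_pairs_oppr.
  have /negPf -> : m != c by rewrite mj; case/andP: jc.
  have := conjprod_longB sigmaV
    (conjprod_diagonal hj hc' jc' (r * f i * f i))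
    (Hmi (r * f i * f j)).
  by rewrite mj; congr (conjprod_long 32 _); rewrite /= mulr1n; ring.
case: (eqVneq m c) => [mc|mc].
  have j'c' : distinct_pairs j' c'.
    by rewrite distinct_pairs_oppl distinct_pairs_oppr.
  have j'i : distinct_pairs j' i by rewrite distinct_pairs_oppl.
  have := conjprod_longB sigmaV (conjprod_longD
    (conjprod_longB sigmaV (conjprod_entry (r * f i * f i) hc hj cj)
      (conjprod_entry (r * f i * f j) hc hi ci))
    (conjprod_entry (r * f i * f i) hj' hc' j'c'))
    (conjprod_entry (r * f i * f c') hj' hi j'i).
  by rewrite mc; congr (conjprod_long 32 _); rewrite /= mulr1n; ring.
have -> : (false%:R : R) = 0 by [].
case: (eqVneq m j') => [mj'|mj'].
  have := conjprod_longB sigmaV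
    (conjprod_antidiagonal hj' (j := i) hi _ (r * f i * f i))
    (Hmi (r * f i * f j)).
  rewrite distinct_pairs_oppl ji th_oppK => /(_ isT).
  move/(conjprod_long_pad sigmaV (M := 32)) => /(_ isT erefl).
  by rewrite mj'; congr (conjprod_long 32 _); ring.
have Dmj : distinct_pairs m j by rewrite /distinct_pairs mj mj'.
have := conjprod_longB sigmaV (conjprod_entry (r * f i * f i) hm hj Dmj)
    (Hmi (r * f i * f j)).
move/(conjprod_long_pad sigmaV (M := 32)) => /(_ isT erefl).
by congr (conjprod_long 32 _); ring.
Qed.

End RowFixing.

(** Take for [t] the vector sigma e_-j without its components along e_-j, e_i, e_-i. As B(sigma
    e_-j, sigma e_j) = 1, B(t, sigma e_j) is the defect up to multiples of sigma_ij and
    sigma_{-i,j}. *)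
Lemma conjprod_diagonal_defect i j r : i \in hb n -> j \in hb n ->
  distinct_pairs i j ->
  conjprod_long 24 (r * (1 - sigma j j * sigma (th_opp j) (th_opp j))).
Proof.
move=> hi hj ij; set i' := th_opp i; set j' := th_opp j.
have frame := (bil_distinct hi hj ij, bil_hyperbolic hi,
  bil_hyperbolic hj).
have hi' : i' \in hb n by rewrite hb_opp.
pose t := sigma *m ev j' - sigma j' j' *: ev j' - sigma i j' *: ev i
  - sigma i' j' *: ev i'.
have it : bil (ev i) t = 0.
  by rewrite !bil_simp bil_ev_sigma // !frame; ring.
have ti' : bil t (ev i') = 0.
  by rewrite bilC !bil_simp bil_ev_sigma // th_oppK !frame; ring.
have tj : bil t (ev j) = 0.
  by rewrite bilC !bil_simp bil_ev_sigma // !frame; ring.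
have := conjprod_bil hi hj ij (sigma i' j') (sigma i j') r it ti' tj.
congr (conjprod_long 24 (_ * _)).
rewrite !bil_simp (isometry_bil _ _ sigmaQ) !bil_ev_sigma ?hb_opp //.
by rewrite !th_oppK !frame; ring.
Qed.

Lemma conjprod_row0_short j : j \in hb n ->
  conjprod_short (64 * n + 148) (sigma (th0 n) j).
Proof.
move=> hj; have [i [hi ij _]] := exists_third_index j j n3.
have [c [hc ci cj]] := exists_third_index i j n3.
have ji : distinct_pairs j i by rewrite distinct_pairsC.
pose s := sigma (th_opp i) (th_opp i); pose r := s ^+ 2.
have hi' : th_opp i \in hb n by rewrite hb_opp.
have [iy Hy] := conjprod_minor_vec hi hj hc ij ci cj r.
have := conjprod_coord0 hi' iy Hy (N := 32) isT
  (conjprod_minor_coord hi hj hc ij ci cj r).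
have -> : minor_vec i j c r o 0 =
    r * sigma i i * (sigma i i * sigma o j - sigma i j * sigma o i).
  rewrite /minor_vec -(mulmx_ev sigma j o) -(mulmx_ev sigma i o).
  move: (sigma *m ev j) (sigma *m ev i) => u w; rewrite !mxE !eqxx !andbT.
  move: hj hc; rewrite !hbE [_ == j]eq_sym [_ == c]eq_sym.
  move=> /negPf -> /negPf ->.
  by rewrite mulr0n; ring.
move=> Hmain.
have Hij := conjprod_short_of_long
  (conjprod_entry (r * sigma i i * sigma o i) hi hj ij).
(* 1 - r f_i^2 = (1 + f_i s) (1 - f_i s). *)
have Hdefect := conjprod_short_of_long (conjprod_diagonal_defect
  (sigma o j * (1 + sigma i i * s)) hj hi ji).
(* The bound obtained is 64n + 140, padded by 8. *)
apply: (conjprod_short_pad (N := 44 + 32 * n.*2 + 24 + 72)); [lia|lia|].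
have := conjprod_shortD (conjprod_shortD Hmain Hij) Hdefect.
by congr (conjprod_short _ _); rewrite -/s /r; ring.
Qed.

End Orthogonal.

(** * The difference of sigma_00 and a diagonal entry *)

Section Orthogonal.

Hypothesis n3 : (3 <= n)%N.
Variables (sigma sigma' : Mat).
Hypothesis sigmaV : inverse_mx sigma sigma'.
Hypothesis sigmaQ : q_isometry sigma.

Local Notation H := (product_of_conjugates sigma).
Local Notation conjprod_long := (conjprod_long sigma).
Local Notation conjprod_short := (conjprod_short sigma).

Lemma conjprod_diagonal0_short j : j \in hb n ->
  conjprod_short (192 * n + 564) (sigma o o - sigma j j).
Proof.
move=> hj; have [i [hi ij _]] := exists_third_index j j n3.
have ji : distinct_pairs j i by rewrite distinct_pairsC.
have hj' : th_opp j \in hb n by rewrite hb_opp.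
have frame := (bil_hyperbolic hj).
set j' := th_opp j in hj' frame *.
pose t : Mat := esd (ev j') (- ev o); pose t' : Mat := esd (ev j') (- - ev o).
have Et : EO t by apply: EO_esd; rewrite ?bil_simp ?frame ?oppr0.
have tt' : inverse_mx t t'.
  by apply: esd_inverse; rewrite ?bil_simp ?frame ?oppr0.
have Hconj : conjprod_short (64 * n + 148) ((t * sigma * t') o j).
  move=> k hk; apply: (conjprod_change sigmaV Et tt').
  exact: (conjprod_row0_short n3 (inverse_mx_conj sigmaV tt')
    (isometry_conj sigmaQ (EO_isometry Et) tt') hj).
(* This entry contains sigma_jj - sigma_00; its other terms are covered by the bounds for row 0,
   column 0 and the antidiagonal. *)
have E : (t * sigma * t') o j = sigma o j - sigma o o - sigma o j'
    + (sigma j j - sigma j o - sigma j j').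
  rewrite -[LHS]mulmx_ev !mulmx_mul.
  have -> : t' *m ev j = ev j - ev o - ev j'.
    rewrite esdE !bil_simp !frame quadQ_ev0.
    by apply/colP => a; rewrite !mxE; ring.
  rewrite esdE !mulmxBr !bil_simp !bil_ev0 !bil_ev_sigma // th_oppK.
  rewrite -(mulmx_ev sigma j o) -(mulmx_ev sigma o o) -(mulmx_ev sigma j' o).
  move: (sigma *m ev j) (sigma *m ev o) (sigma *m ev j') => u v w.
  rewrite quadQ_ev0 !mxE !eqxx.
  by move: hj'; rewrite hbE eq_sym => /negPf ->; rewrite mulr0n mulr1n; ring.
have Hrow0 k := conjprod_row0_short n3 sigmaV sigmaQ (j := k).
have Hcol0 := conjprod_short_of_long n3 sigmaV
  (conjprod_col0 n3 sigmaV sigmaQ hj hi ji 1).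
have Hanti := conjprod_short_of_long n3 sigmaV
  (conjprod_antidiagonal n3 sigmaV sigmaQ hj hi ji 1).
have := conjprod_shortD (conjprod_shortD (conjprod_shortD (conjprod_shortD
  (Hrow0 _ hj) (conjprod_shortN sigmaV (Hrow0 _ hj')))
  (conjprod_shortN sigmaV Hconj)) (conjprod_shortN sigmaV Hcol0))
  (conjprod_shortN sigmaV Hanti).
(* Three uses of the row 0 bound, then 3 * 24 and 3 * 16. *)
rewrite (_ : _ + (16 + 16 + 16) = 192 * n + 564)%N; last by lia.
by congr (conjprod_short _ _); rewrite E; ring.
Qed.

End Orthogonal.

End Transvections.

Theorem theorem22 (n : nat) (R : comNzRingType) (hn : (3 <= n)%N)
  (sigma : 'M[R]_n.*2.+1) (hsigma : in_O sigma)
  (i j k l : 'I_n.*2.+1)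
  (hi : i \in hb n) (hj : j \in hb n) (hk : k \in hb n) (hl : l \in hb n)
  (hij : i != j) (hij' : i != th_opp j) (hkl : k != l) (hkl' : k != th_opp l) :
  product_of_conjugates sigma 8 (Tl k l (sigma i j)) /\
  product_of_conjugates sigma 16 (Tl k l (sigma i (th_opp i))) /\
  product_of_conjugates sigma 24 (Tl k l (sigma i (th0 n))) /\
  product_of_conjugates sigma 24 (Tl k l (2%:R * sigma (th0 n) j)) /\
  product_of_conjugates sigma 24 (Tl k l (sigma i i - sigma j j)) /\
  product_of_conjugates sigma 48
    (Tl k l (sigma i i - sigma (th_opp i) (th_opp i))) /\
  product_of_conjugates sigma (64 * n + 148) (Ts k (sigma (th0 n) j)) /\
  product_of_conjugates sigma (192 * n + 564)
    (Ts k (sigma (th0 n) (th0 n) - sigma j j)).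
Proof.
have [[sigma' sigmaV] sigmaQ] := hsigma.
have ij : distinct_pairs i j by rewrite /distinct_pairs hij.
have ji' : distinct_pairs j (th_opp i).
  by rewrite distinct_pairs_oppr distinct_pairsC.
have kl : distinct_pairs k (th_opp l).
  by rewrite distinct_pairs_oppr /distinct_pairs hkl.
have [hi' hl'] : th_opp i \in hb n /\ th_opp l \in hb n by rewrite !hb_opp.
have long N x :
    conjprod_long sigma N (1 * x) -> product_of_conjugates sigma N (Tl k l x).
  by rewrite mul1r TlE // => Hx; apply: Hx.
have short N x :
    conjprod_short sigma N x -> product_of_conjugates sigma N (Ts k x).
  (* T_k(x) is E(e_k, - x e_0), hence the change of sign. *)
  by rewrite TsE // => /(conjprod_shortN sigmaV) Hx; apply: Hx.
split; first by apply: long; apply: (conjprod_entry hn sigmaV sigmaQ).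
split.
  exact: (long _ _ (conjprod_antidiagonal hn sigmaV sigmaQ hi hj ij 1)).
split; first exact: (long _ _ (conjprod_col0 hn sigmaV sigmaQ hi hj ij 1)).
split; first exact: (long _ _ (conjprod_row0 hn sigmaV sigmaQ hi hj ij 1)).
split; first exact: (long _ _ (conjprod_diagonal hn sigmaV sigmaQ hi hj ij 1)).
split.
  (* The difference is split at sigma_jj. *)
  have := conjprod_longD (conjprod_diagonal hn sigmaV sigmaQ hi hj ij 1)
    (conjprod_diagonal hn sigmaV sigmaQ hj hi' ji' 1).
  by rewrite -mulrDr addrA subrK => /long.
split; first exact: (short _ _ (conjprod_row0_short hn sigmaV sigmaQ hj)).
exact: (short _ _ (conjprod_diagonal0_short hn sigmaV sigmaQ hj)).
Qed.
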